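(* Let $\kappa$ be a regular cardinal and let $\mathsf{A}$ be a $\kappa$-accessible category such that pullbacks of split epimorphisms (along arbitrary morphisms) exist in the category $\mathsf{A}_{<\kappa}$. Then all pullbacks of strongly $\kappa$-pure epimorphisms (along arbitrary morphisms) exist in $\mathsf{A}$, and all such pullbacks are strongly $\kappa$-pure epimorphisms themselves.
   Context: A category $\mathsf{A}$ with $\kappa$-directed colimits is $\kappa$-accessible if there is a set of $\kappa$-presentable objects such that every object of $\mathsf{A}$ is a $\kappa$-directed colimit of objects from this set; $S$ is $\kappa$-presentable if $\mathrm{Hom}_{\mathsf{A}}(S,-)$ preserves $\kappa$-directed colimits. $\mathsf{A}_{<\kappa}$ is the full subcategory of $\kappa$-presentable objects. $\mathsf{A}^{\to}$ is the category whose objects are the morphisms in $\mathsf{A}$ and whose morphisms are the commutative squares. A split epimorphism is a morphism $p\colon B\to A$ for which there is $s\colon A\to B$ with $p\circ s=\mathrm{id}_A$. A morphism in $\mathsf{A}$ is a strongly $\kappa$-pure epimorphism if it is a $\kappa$-directed colimit in $\mathsf{A}^{\to}$ of split epimorphisms between $\kappa$-presentable objects of $\mathsf{A}$. The pullback of a morphism $p\colon D\to E$ along $f\colon E'\to E$ is the morphism $p'\colon D'\to E'$ in the pullback square of the cospan $(p,f)$. *)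

(* Defs.v *)
From Stdlib Require Import Relation_Definitions.
From mathcomp Require Import ssreflect ssrfun ssrbool eqtype.
From mathcomp Require Import boolp classical_sets functions cardinality.

Set Implicit Arguments.
Unset Strict Implicit.
Unset Printing Implicit Defensive.

Local Open Scope classical_set_scope.
Local Open Scope card_scope.

(* A fixed universe: elements of [Small] play the role of sets.  Objects of a
   category live in a larger universe (proper classes are allowed). *)
Definition Small := Type.

Definition card_lt T U (A : set T) (B : set U) : Prop :=
  A #<= B /\ ~~ (B #<= A).

(* A cardinal is represented by a set [K] of that cardinality. *)
Definition regular_cardinal (K : Small) : Prop :=
  infinite_set [set: K] /\
  forall (I : Small) (F : I -> Small),
    card_lt [set: I] [set: K] ->
    (forall i, card_lt [set: F i] [set: K]) ->
    card_lt [set: {i : I & F i}] [set: K].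

(* Locally small: the homs are in [Small]. *)
Record category := Category {
  obj :> Type;
  hom : obj -> obj -> Small;
  idm : forall X, hom X X;
  comp : forall X Y Z, hom Y Z -> hom X Y -> hom X Z;
  comp_idl : forall X Y (f : hom X Y), comp (idm Y) f = f;
  comp_idr : forall X Y (f : hom X Y), comp f (idm X) = f;
  compA : forall W X Y Z (h : hom Y Z) (g : hom X Y) (f : hom W X),
    comp h (comp g f) = comp (comp h g) f
}.

Arguments hom {c} X Y.
Arguments idm {c} X.
Arguments comp {c X Y Z} g f.

Declare Scope cat_scope.
Notation "g ∘ f" := (comp g f) (at level 40, left associativity) : cat_scope.
Local Open Scope cat_scope.

Record functor (A B : category) := Functor {
  fobj :> A -> B;
  fmap : forall X Y : A, hom X Y -> hom (fobj X) (fobj Y);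
  fmap_id : forall X, fmap (idm X) = idm (fobj X);
  fmap_comp : forall X Y Z (g : hom Y Z) (f : hom X Y),
    fmap (g ∘ f) = fmap g ∘ fmap f
}.

Section FunctorComp.
Variables (A B C : category) (G : functor B C) (F : functor A B).

Let gf_map (X Y : A) (f : hom X Y) := fmap G (fmap F f).

Lemma functor_comp_id X : gf_map (idm X) = idm (G (F X)).
Proof. by rewrite /gf_map !fmap_id. Qed.

Lemma functor_comp_comp X Y Z (g : hom Y Z) (f : hom X Y) :
  gf_map (g ∘ f) = gf_map g ∘ gf_map f.
Proof. by rewrite /gf_map !fmap_comp. Qed.

Definition functor_comp : functor A C :=
  Functor functor_comp_id functor_comp_comp.
End FunctorComp.

Definition SetCat : category :=
  @Category Small (fun X Y => X -> Y) (fun X x => x)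
    (fun X Y Z g f x => g (f x))
    (fun _ _ _ => erefl) (fun _ _ _ => erefl) (fun _ _ _ _ _ _ _ => erefl).

Section HomFunctor.
Variables (A : category) (S : A).

Let post (X Y : A) (f : hom X Y) : @hom SetCat (hom S X) (hom S Y) :=
  fun u => f ∘ u.

Lemma post_id X : post (idm X) = idm (hom S X : SetCat).
Proof. by apply: funext => u; exact: comp_idl. Qed.

Lemma post_comp X Y Z (g : hom Y Z) (f : hom X Y) :
  post (g ∘ f) = post g ∘ post f.
Proof. by apply: funext => u; rewrite /post /= compA. Qed.

Definition hom_functor : functor A SetCat :=
  @Functor A SetCat (fun X => hom S X) post post_id post_comp.
End HomFunctor.

Definition full_subcategory (A : category) (P : A -> Prop) : category :=
  @Category {X : A | P X} (fun X Y => hom (sval X) (sval Y))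
    (fun X => idm (sval X)) (fun _ _ _ g f => g ∘ f)
    (fun _ _ f => comp_idl f) (fun _ _ f => comp_idr f)
    (fun _ _ _ _ h g f => compA h g f).

Section ArrowCategory.
Variable A : category.

Record arrow := Arrow { arr_dom : A; arr_cod : A; arr : hom arr_dom arr_cod }.

Record square (f g : arrow) : Small := Square {
  sq_dom : hom (arr_dom f) (arr_dom g);
  sq_cod : hom (arr_cod f) (arr_cod g);
  sq_comm : arr g ∘ sq_dom = sq_cod ∘ arr f
}.

Lemma square_eq f g (u v : square f g) :
  sq_dom u = sq_dom v -> sq_cod u = sq_cod v -> u = v.
Proof.
case: u v => [a b p] [a' b' p'] /= ea eb; subst a' b'.
by rewrite (Prop_irrelevance p p').
Qed.

Lemma square_id_comm f : arr f ∘ idm (arr_dom f) = idm (arr_cod f) ∘ arr f.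
Proof. by rewrite comp_idl comp_idr. Qed.

Lemma square_comp_comm f g h (v : square g h) (u : square f g) :
  arr h ∘ (sq_dom v ∘ sq_dom u) = (sq_cod v ∘ sq_cod u) ∘ arr f.
Proof. by rewrite compA sq_comm -compA sq_comm compA. Qed.

Definition square_id f : square f f := Square (square_id_comm f).
Definition square_comp f g h (v : square g h) (u : square f g) : square f h :=
  Square (square_comp_comm v u).

Lemma square_comp_idl f g (u : square f g) : square_comp (square_id g) u = u.
Proof. by apply: square_eq; exact: comp_idl. Qed.

Lemma square_comp_idr f g (u : square f g) : square_comp u (square_id f) = u.
Proof. by apply: square_eq; exact: comp_idr. Qed.

Lemma square_compA e f g h (w : square g h) (v : square f g) (u : square e f) :
  square_comp w (square_comp v u) = square_comp (square_comp w v) u.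
Proof. by apply: square_eq; exact: compA. Qed.

Definition arrow_category : category :=
  Category square_comp_idl square_comp_idr square_compA.
End ArrowCategory.

Arguments Arrow {A arr_dom arr_cod} arr.

Record poset := Poset {
  pcarrier : Small;
  ple : Relation_Definitions.relation pcarrier;
  ple_order : Relation_Definitions.order pcarrier ple
}.

Definition poset_category (I : poset) : category :=
  @Category (pcarrier I) (@ple I)
    (ord_refl _ _ (ple_order I))
    (fun _ _ _ jk ij => ord_trans _ _ (ple_order I) _ _ _ ij jk)
    (fun _ _ _ => Prop_irrelevance _ _) (fun _ _ _ => Prop_irrelevance _ _)
    (fun _ _ _ _ _ _ _ => Prop_irrelevance _ _).

Definition directed (K : Small) (I : poset) : Prop :=
  forall S : set (pcarrier I), card_lt S [set: K] -> exists u, forall i, S i -> ple i u.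

Record cocone (J A : category) (D : functor J A) (X : A) := Cocone {
  leg : forall j : J, hom (D j) X;
  leg_natural : forall (i j : J) (u : hom i j), leg j ∘ fmap D u = leg i
}.

Definition is_colimit (J A : category) (D : functor J A) (X : A)
    (c : cocone D X) : Prop :=
  forall (Y : A) (d : cocone D Y),
    exists! h : hom X Y, forall j, h ∘ leg c j = leg d j.

Section MapCocone.
Variables (J A B : category) (G : functor A B) (D : functor J A) (X : A).
Variable c : cocone D X.

Lemma map_leg_natural (i j : J) (u : hom i j) :
  fmap G (leg c j) ∘ fmap (functor_comp G D) u = fmap G (leg c i).
Proof. by rewrite /= -fmap_comp leg_natural. Qed.

Definition map_cocone : cocone (functor_comp G D) (G X) :=
  @Cocone J B (functor_comp G D) (G X) (fun j => fmap G (leg c j))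
    map_leg_natural.
End MapCocone.

Definition has_directed_colimits (K : Small) (A : category) : Prop :=
  forall (I : poset), directed K I ->
  forall D : functor (poset_category I) A,
    exists (X : A) (c : cocone D X), is_colimit c.

Definition preserves_directed_colimits (K : Small) (A B : category)
    (G : functor A B) : Prop :=
  forall (I : poset), directed K I ->
  forall (D : functor (poset_category I) A) (X : A) (c : cocone D X),
    is_colimit c -> is_colimit (map_cocone G c).

Definition is_directed_colimit_of (K : Small) (A : category) (P : A -> Prop)
    (X : A) : Prop :=
  exists I : poset, directed K I /\
  exists D : functor (poset_category I) A, (forall i, P (D i)) /\
  exists c : cocone D X, is_colimit c.

Definition presentable (K : Small) (A : category) (S : A) : Prop :=
  preserves_directed_colimits K (hom_functor S).

Definition presentables (K : Small) (A : category) : category :=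
  full_subcategory (@presentable K A).

(* The set of generating objects is given as a family [S] indexed by a set. *)
Definition accessible (K : Small) (A : category) : Prop :=
  has_directed_colimits K A /\
  exists (G : Small) (S : G -> A), (forall g, presentable K (S g)) /\
    forall X : A, is_directed_colimit_of K (fun Y => exists g, Y = S g) X.

Definition split_epi (A : category) (B X : A) (p : hom B X) : Prop :=
  exists s : hom X B, p ∘ s = idm X.

(*  D' --q--> D
    |p'       |p
    E' --f--> E   *)
Definition is_pullback (A : category) (D E E' D' : A)
    (p : hom D E) (f : hom E' E) (p' : hom D' E') (q : hom D' D) : Prop :=
  p ∘ q = f ∘ p' /\
  forall (X : A) (a : hom X D) (b : hom X E'), p ∘ a = f ∘ b ->
    exists! h : hom X D', q ∘ h = a /\ p' ∘ h = b.

Definition has_pullback (A : category) (D E E' : A)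
    (p : hom D E) (f : hom E' E) : Prop :=
  exists (D' : A) (p' : hom D' E') (q : hom D' D), is_pullback p f p' q.

Definition strongly_pure_epi (K : Small) (A : category) (B X : A)
    (p : hom B X) : Prop :=
  @is_directed_colimit_of K (arrow_category A)
    (fun f => [/\ presentable K (arr_dom f), presentable K (arr_cod f)
                & split_epi (arr f)])
    (Arrow p).

(* Main.v *)
From Stdlib Require Import Relation_Definitions.
From mathcomp Require Import ssreflect ssrfun ssrbool.
From mathcomp Require Import boolp classical_sets cardinality.
Require Import Defs.

(** Let [p] be the colimit of split epimorphisms [p_i : D_i -> E_i] and let
    [E'] be the colimit of presentable objects [E'_j].  Since each [E'_j] is
    presentable, [f] restricted to [E'_j] factors through some [E_i], and any
    two such factorizations agree further up in the first diagram.  Hence the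
    factorizations [(i, j, g : E'_j -> E_i)] form a directed poset, which is
    cofinal over both index posets ([directed_reindexing]): along it, [p] and
    [f] are colimits of one diagram of cospans
    [D_t --p_t--> E_t <--g_t-- E'_t] of presentable objects with [p_t] a split
    epimorphism.

    Form the pullback [P_t] of every such cospan among the presentable objects.
    Its projection [P_t -> E'_t] is again a split epimorphism, and the [P_t]
    form a diagram; let [D0] be its colimit.  The induced [p0 : D0 -> E'] is
    strongly pure by construction, colimits of arrows being computed
    objectwise.  That [D0] is a pullback of [p] along [f] says that directed
    colimits commute with these pullbacks.  Mapping out of a presentable [S]
    turns directed colimits into directed colimits of sets, so for such test
    objects one can lift to some stage, where [P_t] is a pullback
    ([pullback_colimit_presentable]).  Presentable test objects suffice, because
    every object is a colimit of them ([is_pullback_presentable_test]).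

    Any other pullback of [p] along [f] is isomorphic to [p0] in the arrow
    category, and being a directed colimit of a class of objects is invariant
    under isomorphism. *)

Set Implicit Arguments.
Unset Strict Implicit.
Unset Printing Implicit Defensive.

Local Open Scope classical_set_scope.
Local Open Scope card_scope.
Local Open Scope cat_scope.

(** * Directed posets *)

Section PosetOrder.
Variable I : poset.

Lemma ple_refl (i : pcarrier I) : ple i i.
Proof. exact: (ord_refl _ _ (ple_order I)). Qed.

Lemma ple_trans (i j k : pcarrier I) : ple i j -> ple j k -> ple i k.
Proof. exact: (ord_trans _ _ (ple_order I)). Qed.

Lemma ple_antisym (i j : pcarrier I) : ple i j -> ple j i -> i = j.
Proof. exact: (ord_antisym _ _ (ple_order I)). Qed.

Lemma poset_hom_eq (i j : poset_category I) (a b : hom i j) : a = b.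
Proof. exact: (@Prop_irrelevance (ple i j) a b). Qed.

End PosetOrder.

Section Directed.
Variables (K : Small) (infK : infinite_set [set: K]).

Lemma card_lt_finite (T : Type) (S : set T) :
  finite_set S -> card_lt S [set: K].
Proof.
move=> finS; split.
  by apply: card_le_trans (finite_set_countable finS) _; exact/infiniteP.
by apply/negP => KS; apply: infK; exact: card_le_finite KS finS.
Qed.

Lemma card_lt_image (T U : Type) (S : set T) (f : T -> U) :
  card_lt S [set: K] -> card_lt (f @` S) [set: K].
Proof.
move=> [SK /negP KS]; split; first exact: card_le_trans (card_image_le f S) SK.
by apply/negP => Kf; apply: KS; exact: card_le_trans Kf (card_image_le f S).
Qed.

Variables (I : poset) (dI : directed K I).

Lemma directed_family_bound (T : Type) (S : set T) (f : T -> pcarrier I) :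
  card_lt S [set: K] -> exists u, forall s, S s -> ple (f s) u.
Proof.
move=> /(card_lt_image f)/dI[u hu]; exists u => s Ss.
by apply: hu; exists s.
Qed.

Lemma directed_inhabited : exists i : pcarrier I, True.
Proof.
by have [u _] := dI (card_lt_finite (@finite_set0 (pcarrier I))); exists u.
Qed.

Lemma directed_pair_bound (i j : pcarrier I) : exists u, ple i u /\ ple j u.
Proof.
have [u hu] := dI (card_lt_finite (finite_set2 i j)).
by exists u; split; apply: hu; [left | right].
Qed.

End Directed.

Section PosetFunctor.
Variables (I : poset) (A : category) (F : functor (poset_category I) A).

Lemma fmap_ple_refl (i : pcarrier I) (ii : ple i i) : fmap F ii = idm (F i).
Proof. by rewrite -fmap_id (Prop_irrelevance ii (idm (i : poset_category I))). Qed.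

Lemma fmap_ple_trans (i j k : pcarrier I) (ij : ple i j) (jk : ple j k)
  (ik : ple i k) : fmap F jk ∘ fmap F ij = fmap F ik.
Proof.
by rewrite -fmap_comp (Prop_irrelevance ik ((jk : @hom (poset_category I) j k) ∘ ij)).
Qed.

End PosetFunctor.

(** * Colimits *)

Section Colimits.
Variables (J A : category) (D : functor J A).

Lemma postcomp_natural X Y (c : cocone D X) (u : hom X Y) i j (a : hom i j) :
  (u ∘ leg c j) ∘ fmap D a = u ∘ leg c i.
Proof. by rewrite -compA leg_natural. Qed.

Definition postcomp_cocone X Y (c : cocone D X) (u : hom X Y) : cocone D Y :=
  Cocone (postcomp_natural c u).

Lemma colimit_ext X (c : cocone D X) Y (u v : hom X Y) : is_colimit c ->
  (forall j, u ∘ leg c j = v ∘ leg c j) -> u = v.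
Proof.
move=> hc uv; have [h [_ hU]] := hc Y (postcomp_cocone c v).
by rewrite -(hU u uv) -(hU v).
Qed.

Lemma colimit_desc X (c : cocone D X) Y (d : cocone D Y) : is_colimit c ->
  exists h : hom X Y, forall j, h ∘ leg c j = leg d j.
Proof. by move=> hc; have [h [hh _]] := hc Y d; exists h. Qed.

Lemma is_colimit_intro X (c : cocone D X) :
  (forall Y (d : cocone D Y), exists h : hom X Y,
     forall j, h ∘ leg c j = leg d j) ->
  (forall Y (u v : hom X Y),
     (forall j, u ∘ leg c j = v ∘ leg c j) -> u = v) ->
  is_colimit c.
Proof.
move=> ex ext Y d; have [h hh] := ex Y d.
by exists h; split=> // h' hh'; apply: ext => j; rewrite hh hh'.
Qed.

Lemma is_colimit_iso X (c : cocone D X) Y (d : cocone D Y)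
  (u : hom X Y) (v : hom Y X) : is_colimit c ->
  (forall j, u ∘ leg c j = leg d j) -> u ∘ v = idm Y -> v ∘ u = idm X ->
  is_colimit d.
Proof.
move=> hc ud uv vu; apply: is_colimit_intro => [Z e | Z a b ab].
  have [h hh] := colimit_desc e hc.
  by exists (h ∘ v) => j; rewrite -ud -compA (compA v) vu comp_idl.
have : a ∘ u = b ∘ u.
  by apply: (colimit_ext hc) => j; rewrite -!compA ud ab.
by move/(congr1 (fun w => w ∘ v)); rewrite -!compA uv !comp_idr.
Qed.

End Colimits.

Lemma is_directed_colimit_of_iso (K : Small) (A : category) (P : A -> Prop)
  (X Y : A) (u : hom X Y) (v : hom Y X) :
  u ∘ v = idm Y -> v ∘ u = idm X ->
  is_directed_colimit_of K P X -> is_directed_colimit_of K P Y.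
Proof.
move=> uv vu [I [dI [D [PD [c hc]]]]].
exists I; split=> //; exists D; split=> //; exists (postcomp_cocone c u).
exact: is_colimit_iso hc _ uv vu.
Qed.

(** Maps into the set of truth values suffice to detect that every point of a
    colimit of sets comes from the diagram. *)
Lemma set_colimit_surj (J : category) (D : functor J SetCat) (X : SetCat)
  (c : cocone D X) : is_colimit c ->
  forall x : X, exists j (y : D j), leg c j y = x.
Proof.
move=> hc x.
pose u (z : X) : bool := `[< exists j (y : D j), leg c j y = z >].
pose v (z : X) : bool := true.
have uv : (u : @hom SetCat X bool) = v.
  by apply: (colimit_ext hc) => j; apply: funext => y; apply/asboolP; exists j, y.
by have /asboolP : u x by rewrite uv.
Qed.

(** The predicate on the colimit used here holds of the class of [z] exactly
    when [z] gets identified with [x] at some stage; directedness makes it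
    invariant along the diagram. *)
Lemma set_directed_colimit_inj (K : Small) (I : poset)
  (D : functor (poset_category I) SetCat) (X : SetCat) (c : cocone D X) :
  infinite_set [set: K] -> directed K I -> is_colimit c ->
  forall (i : pcarrier I) (x y : D i), leg c i x = leg c i y ->
  exists k (ik : ple i k), fmap D ik x = fmap D ik y.
Proof.
move=> infK dI hc i x y xy.
pose d (j : pcarrier I) (z : D j) : bool :=
  `[< exists k (ik : ple i k) (jk : ple j k), fmap D ik x = fmap D jk z >].
have dnat (j j' : poset_category I) (jj' : hom j j') :
    (d j' : @hom SetCat (D j') bool) ∘ fmap D jj' = d j.
  apply: funext => z; apply/asboolP/asboolP => -[k [ik [jk e]]].
    exists k, ik, (ple_trans jj' jk).
    by rewrite e -(fmap_ple_trans _ jj' jk).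
  have [l [kl j'l]] := directed_pair_bound infK dI k j'.
  have il := ple_trans ik kl.
  have jl := ple_trans jk kl.
  exists l, il, j'l.
  rewrite -(fmap_ple_trans D ik kl) /= e.
  transitivity (fmap D jl z); first by rewrite -(fmap_ple_trans D jk kl).
  by rewrite -(fmap_ple_trans D jj' j'l).
have [h hh] := colimit_desc (Cocone dnat) hc.
have hE (z : D i) : h (leg c i z) = d i z by rewrite -[RHS]/(leg (Cocone dnat) i z) -hh.
have : d i y.
  rewrite -hE -xy hE; apply/asboolP.
  by have ii := ple_refl i; exists i, ii, ii.
move=> /asboolP[k [ik [ik' e]]]; exists k, ik.
by rewrite e (Prop_irrelevance ik' ik).
Qed.

Section MapsFromPresentable.
Variables (K : Small) (infK : infinite_set [set: K]) (A : category).
Variables (I : poset) (dI : directed K I) (D : functor (poset_category I) A).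
Variables (X : A) (c : cocone D X) (hc : is_colimit c).
Variables (S : A) (hS : presentable K S).

Lemma presentable_factor (a : hom S X) :
  exists i (b : hom S (D i)), leg c i ∘ b = a.
Proof. exact: (set_colimit_surj (hS dI hc) a). Qed.

Lemma presentable_factor_above (i : pcarrier I) (a : hom S X) :
  exists k, ple i k /\ exists b : hom S (D k), leg c k ∘ b = a.
Proof.
have [j [b ba]] := presentable_factor a.
have [k [ik jk]] := directed_pair_bound infK dI i j.
exists k; split=> //; exists (fmap D (jk : @hom (poset_category I) j k) ∘ b).
by rewrite compA leg_natural.
Qed.

Lemma presentable_coeq (i : pcarrier I) (u v : hom S (D i)) :
  leg c i ∘ u = leg c i ∘ v ->
  exists k (ik : ple i k),
    fmap D (ik : @hom (poset_category I) i k) ∘ u = fmap D ik ∘ v.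
Proof.
move=> uv.
have [k [ik e]] := set_directed_colimit_inj infK dI (hS dI hc) uv.
by exists k, ik.
Qed.

End MapsFromPresentable.

(** * Restriction along cofinal monotone maps *)

Definition cofinal (T I : poset)
    (u : functor (poset_category T) (poset_category I)) : Prop :=
  forall i : pcarrier I, exists t : pcarrier T, ple i (u t).

Section Restriction.
Variables (T I A : category) (u : functor T I) (D : functor I A).
Variables (X : A) (c : cocone D X).

Lemma restrict_natural (s t : T) (a : hom s t) :
  leg c (u t) ∘ fmap (functor_comp D u) a = leg c (u s).
Proof. exact: (leg_natural c (fmap u a)). Qed.

Definition restrict_cocone : cocone (functor_comp D u) X :=
  @Cocone _ _ (functor_comp D u) X (fun t => leg c (u t)) restrict_natural.

End Restriction.

Lemma restrict_colimit (K : Small) (T I : poset) (A : category)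
  (u : functor (poset_category T) (poset_category I))
  (D : functor (poset_category I) A) (X : A) (c : cocone D X) :
  infinite_set [set: K] -> directed K T -> cofinal u ->
  is_colimit c -> is_colimit (restrict_cocone u c).
Proof.
move=> infK dT cof hc; apply: is_colimit_intro => [Y d | Y a b ab]; last first.
  apply: (colimit_ext hc) => i; have [t it] := cof i.
  by rewrite -(leg_natural c (it : @hom (poset_category I) i (u t)))
    2!compA [a ∘ _](ab t).
(* The leg at [i] is read off at any [t] above [i]. *)
have indep (i : pcarrier I) (s t : pcarrier T) (iS : ple i (u s))
    (it : ple i (u t)) :
    leg d s ∘ fmap D (iS : @hom (poset_category I) i (u s)) =
    leg d t ∘ fmap D (it : @hom (poset_category I) i (u t)).
  have [r [sr tr]] := directed_pair_bound infK dT s t.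
  rewrite -(leg_natural d (sr : @hom (poset_category T) s r)).
  rewrite -(leg_natural d (tr : @hom (poset_category T) t r)) -!compA /=.
  congr (_ ∘ _).
  have ir := ple_trans iS
    (fmap u (sr : @hom (poset_category T) s r)).
  by rewrite !(@fmap_ple_trans _ _ _ _ _ _ _ _ ir).
have [tt htt] := choice cof.
pose l (i : poset_category I) : hom (D i) Y :=
  leg d (tt i) ∘ fmap D (htt i : @hom (poset_category I) i (u (tt i))).
have lnat (i j : poset_category I) (ij : hom i j) : l j ∘ fmap D ij = l i.
  rewrite /l -compA -fmap_comp; exact: indep.
have [h hh] := colimit_desc (Cocone lnat) hc.
exists h => t; rewrite [LHS](hh (u t)) /= /l.
rewrite (indep _ _ t _ (ple_refl _)).
by rewrite fmap_ple_refl comp_idr.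
Qed.

(** * Colimits in the arrow category *)

Section ArrowColimits.
Variable A : category.

Definition dom_functor : functor (arrow_category A) A :=
  @Functor (arrow_category A) A (@arr_dom A) (fun _ _ s => sq_dom s)
    (fun _ => erefl) (fun _ _ _ _ _ => erefl).

Definition cod_functor : functor (arrow_category A) A :=
  @Functor (arrow_category A) A (@arr_cod A) (fun _ _ s => sq_cod s)
    (fun _ => erefl) (fun _ _ _ _ _ => erefl).

Variables (J : category) (F : functor J (arrow_category A)).

Lemma arrow_colimit (B X : A) (p : hom B X) (c : cocone F (Arrow p)) :
  is_colimit (map_cocone dom_functor c) ->
  is_colimit (map_cocone cod_functor c) -> is_colimit c.
Proof.
move=> hd hc; apply: is_colimit_intro => [Y d | Y u v uv].
- have [h0 e0] := colimit_desc (map_cocone dom_functor d) hd.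
  have [h1 e1] := colimit_desc (map_cocone cod_functor d) hc.
  have hsq : arr Y ∘ h0 = h1 ∘ arr (Arrow p).
    apply: (colimit_ext hd) => j; rewrite -!compA.
    rewrite [h0 ∘ _](e0 j) [arr (Arrow p) ∘ _](sq_comm (leg c j)) /=.
    by rewrite (sq_comm (leg d j)) compA; congr (_ ∘ _); rewrite -[LHS](e1 j).
  by exists (@Square A (Arrow p) Y h0 h1 hsq) => j; apply: square_eq;
    [exact: e0 | exact: e1].
- apply: square_eq.
    by apply: (colimit_ext hd) => j; exact: (congr1 (@sq_dom _ _ _) (uv j)).
  by apply: (colimit_ext hc) => j; exact: (congr1 (@sq_cod _ _ _) (uv j)).
Qed.

(** The codomain functor is left adjoint to [X |-> idm X]. *)
Lemma cod_colimit (f : arrow A) (c : cocone F f) :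
  is_colimit c -> is_colimit (map_cocone cod_functor c).
Proof.
move=> hc; apply: is_colimit_intro => [Y d | Y u v uv].
- have sqE j : arr (Arrow (idm Y)) ∘ (leg d j ∘ arr (F j)) = leg d j ∘ arr (F j).
    exact: comp_idl.
  pose e j : @hom (arrow_category A) (F j) (Arrow (idm Y)) :=
    @Square A (F j) (Arrow (idm Y)) _ _ (sqE j).
  have enat i j (a : hom i j) : e j ∘ fmap F a = e i.
    have E : leg d j ∘ sq_cod (fmap F a) = leg d i by exact: (leg_natural d a).
    apply: square_eq; last exact: E.
    by rewrite /= -compA (sq_comm (fmap F a)) compA E.
  have [h hh] := colimit_desc (Cocone enat) hc.
  by exists (sq_cod h) => j; exact: (congr1 (@sq_cod _ _ _) (hh j)).
- have E (w : hom (arr_cod f) Y) :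
      arr (Arrow (idm Y)) ∘ (w ∘ arr f) = w ∘ arr f by exact: comp_idl.
  have /(congr1 (@sq_cod _ _ _)) : @Square A f (Arrow (idm Y)) _ _ (E u) =
      @Square A f (Arrow (idm Y)) _ _ (E v) :> @hom (arrow_category A) _ _.
    apply: (colimit_ext hc) => j; apply: square_eq; last exact: uv.
    rewrite /= -!compA (sq_comm (leg c j)) !compA.
    by congr (_ ∘ _); exact: uv.
  by [].
Qed.

(** If the diagram of domains has some colimit [X0], then [X0 -> arr_cod f] is a
    colimit of arrows as well, hence isomorphic to [f]. *)
Lemma dom_colimit (f : arrow A) (c : cocone F f) (X0 : A)
  (c0 : cocone (functor_comp dom_functor F) X0) :
  is_colimit c0 -> is_colimit c -> is_colimit (map_cocone dom_functor c).
Proof.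
move=> h0 hc; have [v hv] := colimit_desc (map_cocone dom_functor c) h0.
pose r := arr f ∘ v.
have rleg j : arr (Arrow r) ∘ leg c0 j = sq_cod (leg c j) ∘ arr (F j).
  by rewrite /= /r -compA [v ∘ _](hv j) (sq_comm (leg c j)).
pose e j : @hom (arrow_category A) (F j) (Arrow r) :=
  @Square A (F j) (Arrow r) _ _ (rleg j).
have enat i j (a : hom i j) : e j ∘ fmap F a = e i.
  apply: square_eq; first exact: (leg_natural c0 a).
  exact: (congr1 (@sq_cod _ _ _) (leg_natural c a)).
have [u hu] := colimit_desc (Cocone enat) hc.
have vsq : arr f ∘ v = idm (arr_cod f) ∘ arr (Arrow r) by rewrite comp_idl.
pose w : @hom (arrow_category A) (Arrow r) f := @Square A (Arrow r) f _ _ vsq.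
have wu : w ∘ u = idm (f : arrow_category A).
  apply: (colimit_ext hc) => j; rewrite -compA hu comp_idl.
  by apply: square_eq; [exact: hv | exact: comp_idl].
apply: (is_colimit_iso (v := sq_dom u) h0 hv).
  exact: (congr1 (@sq_dom _ _ _) wu).
apply: (colimit_ext h0) => j; rewrite -compA [v ∘ _](hv j) comp_idl.
exact: (congr1 (@sq_dom _ _ _) (hu j)).
Qed.

End ArrowColimits.

(** * Factorizing a morphism through two diagrams *)

Section Factorization.
Variables (K : Small) (infK : infinite_set [set: K]) (A : category).
Variables (I J : poset) (dI : directed K I) (dJ : directed K J).
Variables (E : functor (poset_category I) A) (E' : functor (poset_category J) A).
Variables (X X' : A) (c : cocone E X) (c' : cocone E' X').
Variables (hc : is_colimit c) (f : hom X' X).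
Variable hE' : forall j, presentable K (E' j).

Record factorization : Small := Factorization {
  fact_target : pcarrier I;
  fact_source : pcarrier J;
  fact_map : hom (E' fact_source) (E fact_target);
  fact_comm : leg c fact_target ∘ fact_map = f ∘ leg c' fact_source
}.

(** Comparisons live over the index posets, and two factorizations with the same
    indices are comparable only if equal; so this category is a poset. *)
Definition factorization_le (s t : factorization) : Prop :=
  exists (ij : ple (fact_target s) (fact_target t))
         (kl : ple (fact_source s) (fact_source t)),
    fmap E (ij : @hom (poset_category I) _ _) ∘ fact_map s =
    fact_map t ∘ fmap E' (kl : @hom (poset_category J) _ _).

Lemma factorization_order :
  Relation_Definitions.order factorization factorization_le.
Proof.
split.
- move=> s; exists (ple_refl _), (ple_refl _).
  by rewrite !fmap_ple_refl comp_idl comp_idr.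
- move=> r s t [a [b ab]] [a' [b' ab']].
  exists (ple_trans a a').
  exists (ple_trans b b').
  by rewrite -(fmap_ple_trans E a a') -(fmap_ple_trans E' b b') -compA ab
    compA ab' compA.
- move=> [i j g e] [i' j' g' e'] [/= a [b ab]] [/= a' [b' _]].
  have ii' := ple_antisym a a'.
  have jj' := ple_antisym b b'.
  subst i' j'; move: ab; rewrite !fmap_ple_refl comp_idl comp_idr => gg'.
  by subst g'; congr Factorization; exact: Prop_irrelevance.
Qed.

Definition factorization_poset : poset := Poset factorization_order.

Lemma factorization_le_target (s t : factorization) :
  factorization_le s t -> ple (fact_target s) (fact_target t).
Proof. by case. Qed.

Definition target_functor :
    functor (poset_category factorization_poset) (poset_category I) :=
  @Functor (poset_category factorization_poset) (poset_category I) fact_target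
    factorization_le_target
    (fun _ => poset_hom_eq _ _) (fun _ _ _ _ _ => poset_hom_eq _ _).

Lemma factorization_le_source (s t : factorization) :
  factorization_le s t -> ple (fact_source s) (fact_source t).
Proof. by case=> ij []. Qed.

Definition source_functor :
    functor (poset_category factorization_poset) (poset_category J) :=
  @Functor (poset_category factorization_poset) (poset_category J) fact_source
    factorization_le_source
    (fun _ => poset_hom_eq _ _) (fun _ _ _ _ _ => poset_hom_eq _ _).

Lemma fact_map_natural (s t : pcarrier factorization_poset)
  (st : @hom (poset_category factorization_poset) s t) :
  fmap E (fmap target_functor st) ∘ fact_map s =
  fact_map t ∘ fmap E' (fmap source_functor st).
Proof.
have [ij [kl e]] : factorization_le s t by exact: st.
rewrite (poset_hom_eq (fmap target_functor st) ij).
by rewrite (poset_hom_eq (fmap source_functor st) kl).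
Qed.

Lemma factorization_above (i : pcarrier I) (j : pcarrier J) :
  exists t : factorization, ple i (fact_target t) /\ fact_source t = j.
Proof.
have [k [ik [g e]]] :=
  presentable_factor_above infK dI hc (@hE' j) i (f ∘ leg c' j).
by exists (Factorization e).
Qed.

(** Above fewer than [K] factorizations, take one with large source and
    target.  Its comparison with each given one commutes only after mapping to
    [X], hence at some later stage; a bound of all these stages works for all of
    them at once. *)
Lemma factorization_directed : directed K factorization_poset.
Proof.
move=> S SK.
have [i0 hi0] := directed_family_bound dI fact_target SK.
have [j hj] := directed_family_bound dJ fact_source SK.
have [t [i0t tj]] := factorization_above i0 j.
subst j.
have stage (s : factorization) : exists k, S s ->
    exists (ik : ple (fact_target s) k) (tk : ple (fact_target t) k)
           (jl : ple (fact_source s) (fact_source t)),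
      fmap E (ik : @hom (poset_category I) _ _) ∘ fact_map s =
      fmap E (tk : @hom (poset_category I) _ _) ∘ fact_map t
        ∘ fmap E' (jl : @hom (poset_category J) _ _).
  have [Ss|nSs] := pselect (S s); last by exists (fact_target t).
  have it := ple_trans (hi0 _ Ss) i0t.
  have jl := hj _ Ss.
  have [] := @presentable_coeq _ infK _ _ dI _ _ _ hc _ (@hE' (fact_source s))
    (fact_target t) (fmap E (it : @hom (poset_category I) _ _) ∘ fact_map s)
    (fact_map t ∘ fmap E' (jl : @hom (poset_category J) _ _)).
    rewrite !compA leg_natural !fact_comm -compA.
    by rewrite leg_natural.
  move=> k [tk e]; exists k => _.
  exists (ple_trans it tk), tk, jl.
  by rewrite -(fmap_ple_trans E it tk) -!compA.
have [k hk] := choice stage.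
have [i1 hi1] := directed_family_bound dI k SK.
have [i2 [i12 ti2]] := directed_pair_bound infK dI i1 (fact_target t).
have tcomm : leg c i2 ∘ (fmap E (ti2 : @hom (poset_category I) _ _) ∘ fact_map t) =
    f ∘ leg c' (fact_source t).
  by rewrite compA leg_natural fact_comm.
exists (Factorization tcomm) => s Ss.
have [ik [tk [jl e]]] := hk s Ss.
have ki2 := ple_trans (hi1 s Ss) i12.
exists (ple_trans ik ki2), jl => /=.
by rewrite -(fmap_ple_trans E ik ki2) -compA e !compA (fmap_ple_trans _ tk ki2 ti2).
Qed.

Lemma target_cofinal : cofinal target_functor.
Proof.
move=> i; have [j _] := directed_inhabited infK dJ.
by have [t [it _]] := factorization_above i j; exists t.
Qed.

Lemma source_cofinal : cofinal source_functor.
Proof.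
move=> j; have [i _] := directed_inhabited infK dI.
have [t [_ <-]] := factorization_above i j.
by exists t; exact: ple_refl.
Qed.

End Factorization.

(** Up to reindexing, every morphism from a directed colimit of presentable
    objects to a directed colimit comes from a natural transformation: the poset
    of factorizations carries a tautological one. *)
Lemma directed_reindexing (K : Small) (A : category) (I J : poset)
  (E : functor (poset_category I) A) (E' : functor (poset_category J) A)
  (X X' : A) (c : cocone E X) (c' : cocone E' X') (f : hom X' X) :
  infinite_set [set: K] -> directed K I -> directed K J ->
  is_colimit c -> (forall j, presentable K (E' j)) ->
  exists T : poset, directed K T /\
  exists (u : functor (poset_category T) (poset_category I))
         (v : functor (poset_category T) (poset_category J))
         (g : forall t : poset_category T, hom (E' (v t)) (E (u t))),
    [/\ cofinal u, cofinal v,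
        (forall (s t : poset_category T) (st : hom s t),
           fmap E (fmap u st) ∘ g s = g t ∘ fmap E' (fmap v st))
      & forall t, leg c (u t) ∘ g t = f ∘ leg c' (v t)].
Proof.
move=> infK dI dJ hc hE'.
exists (factorization_poset c c' f); split; first exact: factorization_directed.
exists (target_functor c c' f), (source_functor c c' f).
exists (fun t => fact_map t); split.
- exact: (target_cofinal infK dI dJ c' hc f hE').
- exact: (source_cofinal infK dI c' hc f hE').
- exact: fact_map_natural.
- move=> t; exact: fact_comm.
Qed.

(** * Pullbacks and presentable test objects *)

(** The universal property of a pullback, required only for presentable test
    objects.  When the four objects are presentable, this is the notion of
    pullback in the full subcategory of presentable objects. *)
Definition presentable_pullback (K : Small) (A : category) (D E E' D' : A)
    (p : hom D E) (f : hom E' E) (p' : hom D' E') (q : hom D' D) : Prop :=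
  p ∘ q = f ∘ p' /\
  forall (S : A) (a : hom S D) (b : hom S E'), presentable K S ->
    p ∘ a = f ∘ b -> exists! h : hom S D', q ∘ h = a /\ p' ∘ h = b.

Section PresentablePullback.
Variables (K : Small) (A : category) (D E E' D' : A).
Variables (p : hom D E) (f : hom E' E) (p' : hom D' E') (q : hom D' D).

Lemma presentable_pullback_ext S (h h' : hom S D') : presentable K S ->
  presentable_pullback K p f p' q ->
  q ∘ h = q ∘ h' -> p' ∘ h = p' ∘ h' -> h = h'.
Proof.
move=> hS [comm univ] qh ph.
have [|k [_ kU]] := univ S (q ∘ h) (p' ∘ h) hS; first by rewrite !compA comm.
by rewrite -(kU h) // (kU h').
Qed.

(** A cone on a colimit of presentable objects is a compatible family of cones on
    presentable objects; uniqueness makes the mediating maps compatible too. *)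
Lemma is_pullback_presentable_test :
  (forall X : A, is_directed_colimit_of K (@presentable K A) X) ->
  presentable_pullback K p f p' q -> is_pullback p f p' q.
Proof.
move=> colim ppb; have [comm univ] := ppb; split=> // X a b ab.
have [I [_ [F [FP [c hc]]]]] := colim X.
have lift i : {h : hom (F i) D' | q ∘ h = a ∘ leg c i /\ p' ∘ h = b ∘ leg c i}.
  apply: cid; have [|h [hh _]] := univ _ (a ∘ leg c i) (b ∘ leg c i) (FP i).
    by rewrite !compA ab.
  by exists h.
pose h i := sval (lift i).
have hh i : q ∘ h i = a ∘ leg c i /\ p' ∘ h i = b ∘ leg c i := svalP (lift i).
have hnat i j (ij : hom i j) : h j ∘ fmap F ij = h i.
  apply: (presentable_pullback_ext (FP i) ppb); rewrite compA.
    by rewrite (hh j).1 (hh i).1 -compA leg_natural.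
  by rewrite (hh j).2 (hh i).2 -compA leg_natural.
have [k hk] := colimit_desc (Cocone hnat) hc.
exists k; split.
  split; apply: (colimit_ext hc) => i; rewrite -compA hk /=;
    by have [] := hh i.
move=> k' [qk' pk']; apply: (colimit_ext hc) => i; rewrite hk /=.
apply: (presentable_pullback_ext (FP i) ppb); rewrite compA.
  by rewrite qk' (hh i).1.
by rewrite pk' (hh i).2.
Qed.

(** The section of [p'] is induced by the cone [(s ∘ f, idm E')], where [s] is a
    section of [p]; [E'] has to be a legitimate test object. *)
Lemma presentable_pullback_split_epi : presentable K E' ->
  presentable_pullback K p f p' q -> split_epi p -> split_epi p'.
Proof.
move=> hE' [_ univ] [s ps].
have [|h [[_ ph] _]] := univ E' (s ∘ f) (idm E') hE'.
  by rewrite compA ps comp_idl comp_idr.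
by exists h.
Qed.

End PresentablePullback.

(** * The colimit of a diagram of pullbacks *)

Section ColimitOfPullbacks.
Variables (K : Small) (infK : infinite_set [set: K]) (A : category).
Hypothesis colimA : has_directed_colimits K A.
Variables (T : poset) (dT : directed K T).
Variables (F : functor (poset_category T) (arrow_category A)).
Variables (G : functor (poset_category T) A).
Variable g : forall t, hom (G t) (arr_cod (F t)).
Hypothesis gnat : forall s t (st : hom s t),
  sq_cod (fmap F st) ∘ g s = g t ∘ fmap G st.
Variables (D E E' : A) (p : hom D E) (f : hom E' E).
Variables (cF : cocone F (Arrow p)) (cG : cocone G E').
Hypotheses (hcF : is_colimit cF) (hcG : is_colimit cG).
Hypothesis gf : forall t, sq_cod (leg cF t) ∘ g t = f ∘ leg cG t.
Variables (P : poset_category T -> A).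
Variables (pr : forall t, hom (P t) (G t)) (qr : forall t, hom (P t) (arr_dom (F t))).
Hypothesis hP : forall t, presentable K (P t).
Hypothesis pb : forall t, presentable_pullback K (arr (F t)) (g t) (pr t) (qr t).

Lemma pullback_map_ex s t (st : hom s t) : exists h : hom (P s) (P t),
  qr t ∘ h = sq_dom (fmap F st) ∘ qr s /\ pr t ∘ h = fmap G st ∘ pr s.
Proof.
have [_ univ] := pb t.
have [|h [hh _]] :=
  univ (P s) (sq_dom (fmap F st) ∘ qr s) (fmap G st ∘ pr s) (@hP s).
  by rewrite !compA (sq_comm (fmap F st)) -gnat -!compA (pb s).1.
by exists h.
Qed.

Definition pullback_map s t (st : hom s t) : hom (P s) (P t) :=
  projT1 (cid (pullback_map_ex st)).

Lemma qr_pullback_map s t (st : hom s t) :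
  qr t ∘ pullback_map st = sq_dom (fmap F st) ∘ qr s.
Proof. by rewrite /pullback_map; case: cid => h []. Qed.

Lemma pr_pullback_map s t (st : hom s t) :
  pr t ∘ pullback_map st = fmap G st ∘ pr s.
Proof. by rewrite /pullback_map; case: cid => h []. Qed.

Lemma pullback_map_id t : pullback_map (idm t) = idm (P t).
Proof.
apply: (presentable_pullback_ext (@hP t) (pb t)).
  by rewrite qr_pullback_map fmap_id comp_idr; exact: comp_idl.
by rewrite pr_pullback_map fmap_id comp_idr comp_idl.
Qed.

Lemma pullback_map_comp r s t (st : hom s t) (rs : hom r s) :
  pullback_map (st ∘ rs) = pullback_map st ∘ pullback_map rs.
Proof.
apply: (presentable_pullback_ext (@hP r) (pb t)).
  by rewrite compA !qr_pullback_map -compA qr_pullback_map compA fmap_comp.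
by rewrite compA !pr_pullback_map -compA pr_pullback_map compA fmap_comp.
Qed.

Definition pullback_diagram : functor (poset_category T) A :=
  Functor pullback_map_id pullback_map_comp.

Variables (D0 : A) (cP : cocone pullback_diagram D0) (hcP : is_colimit cP).
Variables (p0 : hom D0 E') (q0 : hom D0 D).
Hypothesis p0E : forall t, p0 ∘ leg cP t = leg cG t ∘ pr t.
Hypothesis q0E : forall t, q0 ∘ leg cP t = sq_dom (leg cF t) ∘ qr t.

Let hcod : is_colimit (map_cocone (cod_functor A) cF).
Proof. exact: cod_colimit. Qed.

(* The colimit of the domains exists because [A] has directed colimits. *)
Let hdom : is_colimit (map_cocone (dom_functor A) cF).
Proof.
have [X0 [c0 h0]] := colimA dT (functor_comp (dom_functor A) F).
exact: dom_colimit h0 hcF.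
Qed.

Lemma pullback_colimit_comm : p ∘ q0 = f ∘ p0.
Proof.
apply: (colimit_ext hcP) => t; rewrite -!compA q0E p0E compA.
rewrite [p ∘ _](sq_comm (leg cF t)) -compA (pb t).1.
by rewrite !compA gf.
Qed.

Lemma pullback_colimit_factor S (a : hom S D) (b : hom S E') :
  presentable K S -> p ∘ a = f ∘ b ->
  exists h : hom S D0, q0 ∘ h = a /\ p0 ∘ h = b.
Proof.
move=> hS ab.
have [s [a0 a0E]] := presentable_factor dT hdom hS a.
have [t [st [b1 b1E]]] := presentable_factor_above infK dT hcG hS s b.
pose a1 := sq_dom (fmap F (st : @hom (poset_category T) s t)) ∘ a0.
have a1E : sq_dom (leg cF t) ∘ a1 = a.
  rewrite /a1 compA -a0E; congr (_ ∘ _).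
  exact: (congr1 (@sq_dom _ _ _) (leg_natural cF (st : @hom (poset_category T) s t))).
(* The two maps to [E_t] only agree in the colimit [E], hence at a later stage. *)
have [|r [tr e]] := @presentable_coeq _ infK _ _ dT _ _ _ hcod _ hS t
    (arr (F t) ∘ a1) (g t ∘ b1).
  by rewrite /= !compA gf -(sq_comm (leg cF t)) -!compA a1E b1E.
pose tr' : @hom (poset_category T) t r := tr.
have [_ univ] := pb r.
have [|h [[qh ph] _]] :=
    univ S (sq_dom (fmap F tr') ∘ a1) (fmap G tr' ∘ b1) hS.
  rewrite !compA (sq_comm (fmap F tr')) -gnat -!compA; exact: e.
exists (leg cP r ∘ h); split; rewrite compA.
  rewrite q0E -compA qh compA -[RHS]a1E; congr (_ ∘ _).
  exact: (congr1 (@sq_dom _ _ _) (leg_natural cF tr')).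
by rewrite p0E -compA ph compA leg_natural.
Qed.

(** Two maps to [D0] with equal projections to [D] and [E'] come from maps to one
    [P_t] whose projections agree at a later stage, where [pb] applies. *)
Lemma pullback_colimit_mono S (h h' : hom S D0) : presentable K S ->
  q0 ∘ h = q0 ∘ h' -> p0 ∘ h = p0 ∘ h' -> h = h'.
Proof.
move=> hS qh ph.
have [s [h0 h0E]] := presentable_factor dT hcP hS h.
have [t [st [h1' h1'E]]] := presentable_factor_above infK dT hcP hS s h'.
pose h1 := fmap pullback_diagram (st : @hom (poset_category T) s t) ∘ h0.
have h1E : leg cP t ∘ h1 = h by rewrite /h1 compA leg_natural.
have [|r [tr e]] := @presentable_coeq _ infK _ _ dT _ _ _ hdom _ hS t
    (qr t ∘ h1) (qr t ∘ h1').
  by rewrite !compA -[leg _ _ ∘ _]q0E -!compA h1E h1'E.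
have [|r' [tr' e']] := @presentable_coeq _ infK _ _ dT _ _ _ hcG _ hS t
    (pr t ∘ h1) (pr t ∘ h1').
  by rewrite !compA -p0E -!compA h1E h1'E.
have [k [rk rk']] := directed_pair_bound infK dT r r'.
pose tk : @hom (poset_category T) t k := ple_trans tr rk.
have hk : fmap pullback_diagram tk ∘ h1 = fmap pullback_diagram tk ∘ h1'.
  apply: (presentable_pullback_ext hS (pb k)); rewrite !compA.
    rewrite qr_pullback_map -!compA.
    have -> : sq_dom (fmap F tk) = fmap (functor_comp (dom_functor A) F)
      (rk : @hom (poset_category T) _ _) ∘ fmap (functor_comp (dom_functor A) F)
      (tr : @hom (poset_category T) _ _).
      by rewrite (@fmap_ple_trans _ _ _ _ _ _ tr rk tk).
    by rewrite -!compA; congr (_ ∘ _); exact: e.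
  rewrite pr_pullback_map -!compA -(@fmap_ple_trans _ _ _ _ _ _ tr' rk' tk).
  by rewrite -!compA e'.
rewrite -h1E -h1'E -(leg_natural cP tk) -!compA.
by congr (_ ∘ _); exact: hk.
Qed.

Lemma pullback_colimit_presentable : presentable_pullback K p f p0 q0.
Proof.
split=> [|S a b hS ab]; first exact: pullback_colimit_comm.
have [h [qh ph]] := pullback_colimit_factor hS ab.
exists h; split=> // h' [qh' ph'].
by apply: (pullback_colimit_mono hS); rewrite ?qh ?ph.
Qed.

Hypothesis hG : forall t, presentable K (G t).
Hypothesis splitF : forall t, split_epi (arr (F t)).

Definition pullback_square s t (st : hom s t) :
    @hom (arrow_category A) (Arrow (pr s)) (Arrow (pr t)) :=
  @Square A (Arrow (pr s)) (Arrow (pr t)) _ _ (pr_pullback_map st).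

Lemma pullback_square_id t :
  pullback_square (idm t) = idm (Arrow (pr t) : arrow_category A).
Proof. by apply: square_eq; [exact: pullback_map_id | exact: fmap_id]. Qed.

Lemma pullback_square_comp r s t (st : hom s t) (rs : hom r s) :
  pullback_square (st ∘ rs) = pullback_square st ∘ pullback_square rs.
Proof. by apply: square_eq; [exact: pullback_map_comp | exact: fmap_comp]. Qed.

Definition projection_diagram : functor (poset_category T) (arrow_category A) :=
  @Functor (poset_category T) (arrow_category A) (fun t => Arrow (pr t))
    pullback_square pullback_square_id pullback_square_comp.

Lemma pullback_colimit_strongly_pure : strongly_pure_epi K p0.
Proof.
exists T; split=> //; exists projection_diagram; split.
  move=> t; split; [exact: hP | exact: hG |].
  exact: presentable_pullback_split_epi (@hG t) (pb t) (splitF t).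
pose l t : @hom (arrow_category A) (Arrow (pr t)) (Arrow p0) :=
  @Square A (Arrow (pr t)) (Arrow p0) _ _ (p0E t).
have lnat s t (st : hom s t) : l t ∘ fmap projection_diagram st = l s.
  by apply: square_eq; [exact: (leg_natural cP st) | exact: (leg_natural cG st)].
exists (Cocone lnat).
apply: arrow_colimit => Y d.
  exact: (hcP (@Cocone _ _ pullback_diagram Y (leg d)
    (fun s t st => leg_natural d st))).
exact: (hcG (@Cocone _ _ G Y (leg d) (fun s t st => leg_natural d st))).
Qed.

End ColimitOfPullbacks.

(** * Pullbacks of strongly pure epimorphisms *)

Section Pullbacks.
Variables (K : Small) (infK : infinite_set [set: K]) (A : category).
Hypothesis hA : accessible K A.
Hypothesis hpb : forall (D E E' : presentables K A) (p : hom D E) (f : hom E' E),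
  split_epi p -> has_pullback p f.

Lemma accessible_presentable_colimit (X : A) :
  is_directed_colimit_of K (@presentable K A) X.
Proof.
have [_ [Gen [S [hS colim]]]] := hA; have [I [dI [D [DS c]]]] := colim X.
exists I; split=> //; exists D; split=> // i.
by have [x ->] := DS i.
Qed.

Lemma split_epi_presentable_pullback (D E E' : A) (p : hom D E) (f : hom E' E) :
  presentable K D -> presentable K E -> presentable K E' -> split_epi p ->
  exists (P : A) (pr : hom P E') (qr : hom P D),
    presentable K P /\ presentable_pullback K p f pr qr.
Proof.
move=> hD hE hE' sp.
have [[P hP] [pr [qr [comm univ]]]] :=
  @hpb (exist _ D hD) (exist _ E hE) (exist _ E' hE') p f sp.
exists P, pr, qr; split=> //; split=> // S a b hS ab.
exact: (univ (exist _ S hS) a b ab).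
Qed.

Lemma strongly_pure_pullback_exists (D E E' : A) (p : hom D E) (f : hom E' E) :
  strongly_pure_epi K p ->
  exists (D0 : A) (p0 : hom D0 E') (q0 : hom D0 D),
    is_pullback p f p0 q0 /\ strongly_pure_epi K p0.
Proof.
move=> [I [dI [F [hF [cF hcF]]]]].
have [J [dJ [G [hG [cG hcG]]]]] := accessible_presentable_colimit E'.
have [T [dT [u [v [g [cofu cofv gnat gf]]]]]] :=
  directed_reindexing cG f infK dI dJ (cod_colimit hcF) hG.
pose FT := functor_comp F u; pose GT := functor_comp G v.
have hcFT := restrict_colimit infK dT cofu hcF.
have hcGT := restrict_colimit infK dT cofv hcG.
pose gT t : hom (GT t) (arr_cod (FT t)) := g t.
have hFT t : [/\ presentable K (arr_dom (FT t)), presentable K (arr_cod (FT t))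
                & split_epi (arr (FT t))] by exact: hF.
have ex t : {w : {P : A & (hom P (GT t) * hom P (arr_dom (FT t)))%type} |
    presentable K (projT1 w) /\ presentable_pullback K
      (arr (FT t)) (gT t) (projT2 w).1 (projT2 w).2}.
  apply: cid; have [hd hcod hs] := hFT t.
  have [P [pr [qr H]]] := split_epi_presentable_pullback (gT t) hd hcod (hG (v t)) hs.
  by exists (existT _ P (pr, qr)).
pose P t := projT1 (sval (ex t)).
pose pr t : hom (P t) (GT t) := (projT2 (sval (ex t))).1.
pose qr t : hom (P t) (arr_dom (FT t)) := (projT2 (sval (ex t))).2.
have hP t : presentable K (P t) := (svalP (ex t)).1.
have pb t : presentable_pullback K (arr (FT t)) (gT t) (pr t) (qr t) :=
  (svalP (ex t)).2.
have gnat' s t (st : hom s t) : sq_cod (fmap FT st) ∘ gT s = gT t ∘ fmap GT st.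
  exact: gnat.
pose PT := pullback_diagram gnat' hP pb.
have [D0 [cP hcP]] := hA.1 _ dT PT.
have pnat s t (st : hom s t) :
    (leg (restrict_cocone v cG) t ∘ pr t) ∘ fmap PT st =
    leg (restrict_cocone v cG) s ∘ pr s.
  by rewrite -compA pr_pullback_map compA leg_natural.
have qnat s t (st : hom s t) :
    (sq_dom (leg (restrict_cocone u cF) t) ∘ qr t)
      ∘ fmap PT st =
    sq_dom (leg (restrict_cocone u cF) s) ∘ qr s.
  rewrite -compA qr_pullback_map compA; congr (_ ∘ _).
  exact: (congr1 (@sq_dom _ _ _) (leg_natural (restrict_cocone u cF) st)).
have [p0 p0E] := colimit_desc (Cocone pnat) hcP.
have [q0 q0E] := colimit_desc (Cocone qnat) hcP.
exists D0, p0, q0; split.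
  apply: (is_pullback_presentable_test accessible_presentable_colimit).
  exact: (pullback_colimit_presentable infK hA.1 dT hcFT hcGT gf hcP p0E q0E).
apply: (pullback_colimit_strongly_pure dT hcGT hcP p0E) => t.
  exact: hG.
by have [] := hFT t.
Qed.

End Pullbacks.

Lemma pullback_unique (A : category) (D E E' D1 D2 : A)
  (p : hom D E) (f : hom E' E) (p1 : hom D1 E') (q1 : hom D1 D)
  (p2 : hom D2 E') (q2 : hom D2 D) :
  is_pullback p f p1 q1 -> is_pullback p f p2 q2 ->
  exists (u : hom D1 D2) (v : hom D2 D1),
    [/\ p2 ∘ u = p1, p1 ∘ v = p2, u ∘ v = idm D2 & v ∘ u = idm D1].
Proof.
move=> [c1 univ1] [c2 univ2].
have [u [[qu pu] _]] := univ2 _ q1 p1 c1.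
have [v [[qv pv] _]] := univ1 _ q2 p2 c2.
exists u, v; split=> //.
  have [w [_ wU]] := univ2 _ q2 p2 c2.
  rewrite -(wU (u ∘ v)) ?(wU (idm D2)) ?comp_idr //.
  by rewrite !compA qu pu.
have [w [_ wU]] := univ1 _ q1 p1 c1.
rewrite -(wU (v ∘ u)) ?(wU (idm D1)) ?comp_idr //.
by rewrite !compA qv pv.
Qed.

Theorem proposition15p1 (K : Small) (A : category)
  (hK : regular_cardinal K)
  (hA : accessible K A)
  (hpb : forall (D E E' : presentables K A) (p : hom D E) (f : hom E' E),
    split_epi p -> has_pullback p f) :
  (forall (D E E' : A) (p : hom D E) (f : hom E' E),
    strongly_pure_epi K p -> has_pullback p f) /\
  (forall (D E E' D' : A) (p : hom D E) (f : hom E' E)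
      (p' : hom D' E') (q : hom D' D),
    strongly_pure_epi K p -> is_pullback p f p' q ->
    strongly_pure_epi K p').
Proof.
have ex := strongly_pure_pullback_exists hK.1 hA hpb; split.
  move=> D E E' p f sp; have [D0 [p0 [q0 [pb _]]]] := ex _ _ _ p f sp.
  by exists D0, p0, q0.
move=> D E E' D' p f p' q sp pb.
have [D0 [p0 [q0 [pb0 sp0]]]] := ex _ _ _ p f sp.
have [u [v [pu pv uv vu]]] := pullback_unique pb0 pb.
have su : arr (Arrow p') ∘ u = idm E' ∘ arr (Arrow p0) by rewrite comp_idl.
have sv : arr (Arrow p0) ∘ v = idm E' ∘ arr (Arrow p') by rewrite comp_idl.
apply: (@is_directed_colimit_of_iso K (arrow_category A) _ (Arrow p0) (Arrow p')
  (@Square A (Arrow p0) (Arrow p') _ _ su) (@Square A (Arrow p') (Arrow p0) _ _ sv))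
  sp0; by apply: square_eq; rewrite //= comp_idl.
Qed.
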